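(* Let $(P_n)_{n\ge 0}$ and $(Q_n)_{n\ge 0}$ be two monic orthogonal polynomial sequences (MOPSs) with respect to the regular functionals $\mathbf u$ and $\mathbf v$, respectively, normalized by $\langle \mathbf u,1\rangle=1=\langle\mathbf v,1\rangle$. Assume that there exist sequences of complex numbers $(r_n)_{n\ge0}$, $(s_n)_{n\ge0}$, $(t_n)_{n\ge0}$, with $r_0=s_0=t_0=t_1=0$, such that $$(\ast)\qquad Q_n(x)+r_nQ_{n-1}(x)=P_n(x)+s_nP_{n-1}(x)+t_nP_{n-2}(x),\qquad n\ge 0 .$$ Then: (i) If $t_2=r_2(s_1-r_1)$ and $s_1=r_1$, then $t_n=0$ for $n\ge2$ and $s_n=r_n$ for $n\ge1$; thus $(\ast)$ reduces to the trivial $1-1$ type relation $Q_n=P_n$, $n\ge0$. (ii) If $t_2=r_2(s_1-r_1)$ and $s_1\ne r_1$, then $t_n=r_n(s_{n-1}-r_{n-1})$ for $n\ge2$ and $s_n\neq r_n$ for $n\ge1$; in this case $(\ast)$ reduces to the $1-2$ type relation $Q_n=P_n+a_nP_{n-1}$, $n\ge0$, where $a_n:=s_n-r_n\ne0$ for $n\ge1$. (iii) If $t_2\neq r_2(s_1-r_1)$ and $r_3=0$, then $t_n\ne r_n(s_{n-1}-r_{n-1})$ for $n\ge2$ and $r_n=0$ for $n\ge3$; in this case $(\ast)$ reduces to the $1-3$ type relation $Q_n=P_n+a_nP_{n-1}+b_nP_{n-2}$, $n\ge0$, where $a_n:=s_n-r_n$ for $n\ge1$ and $b_n:=t_n-r_n(s_{n-1}-r_{n-1})\neq0$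 for $n\ge2$. (iv) If $t_2\ne r_2(s_1-r_1)$ and $r_3\ne0$, then $r_n\neq0$ for $n\ge3$. In addition: (iv-a) If (moreover) $t_3=0$ and $t_2=s_2(s_1-r_1)$, then $t_n=0=s_n$ for $n\ge3$; in this case $(\ast)$ reduces to the $2-1$ type relation $Q_n+c_nQ_{n-1}=P_n$, $n\ge0$, where $c_n:=r_n-s_n\ne0$ for $n\ge1$. (iv-b) If (moreover) $t_3=0$ and $t_2\neq s_2(s_1-r_1)$, then $t_n=0$ for $n\ge3$ and $s_n\ne0$ for $n\ge3$; in this case $(\ast)$ reduces to a $2-2$ type relation. More precisely: $\bullet$ if $s_1\ne r_1$, then $(\ast)$ becomes $Q_n+c_nQ_{n-1}=P_n+d_nP_{n-1}$, $n\ge0$, where $c_1,d_1$ are nonzero complex numbers chosen so that $c_1-d_1=r_1-s_1$, $c_2:=r_2-t_2/(s_1-r_1)$, $d_2:=s_2-t_2/(s_1-r_1)$, and $c_n:=r_n$, $d_n:=s_n$ for $n\ge3$; and $c_nd_n\ne0$ for all $n\ge1$; $\bullet$ if $s_1=r_1$, then $Q_1=P_1$, $Q_2+r_2Q_1=P_2+s_2P_1+t_2$, and $Q_n+r_nQ_{n-1}=P_n+s_nP_{n-1}$ for $n\ge3$. (v) If $t_2\ne r_2(s_1-r_1)$ and $r_3t_3\ne0$, then $r_nt_n\ne0$ for all $n\ge3$. Thus in this case $(\ast)$ is a non-degenerate $2-3$ type relation.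
   Context: A functional here is a linear functional $\mathbf w$ on the space of complex polynomials in one variable; $\langle\mathbf w,p\rangle$ is its value at $p$. A MOPS with respect to $\mathbf w$ is a sequence $(R_n)_{n\ge0}$ of monic polynomials with $\deg R_n=n$, $\langle\mathbf w,R_nR_m\rangle=0$ for $n\neq m$ and $\langle\mathbf w,R_n^2\rangle\ne0$ for all $n$; $\mathbf w$ is regular (quasi-definite) if such a sequence exists. Polynomials with negative index are zero. An $M-N$ type structure relation ($M,N$ fixed positive integers) linking $(P_n)_n$ and $(Q_n)_n$ is a relation $Q_n+\sum_{i=1}^{M-1}r_{i,n}Q_{n-i}=P_n+\sum_{i=1}^{N-1}s_{i,n}P_{n-i}$, $n\ge0$, with complex coefficients $r_{i,n},s_{i,n}$ (empty sum equals zero). The $2-3$ type relation $(\ast)$ is called degenerate if there exists another structure relation of type $M-N$ linking $(P_n)_n$ and $(Q_n)_n$ with $M<2$ or $N<3$; otherwise it is non-degenerate. *)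

(* Defs.v *)
From mathcomp Require Import all_boot all_order all_algebra.
From mathcomp Require Import complex reals.

Set Implicit Arguments.
Unset Strict Implicit.
Unset Printing Implicit Defensive.

Import GRing.Theory.
Local Open Scope ring_scope.

Section OrthogonalPolynomials.

Variable K : fieldType.
Implicit Types (w : {scalar {poly K}}) (P Q : nat -> {poly K}).

Definition is_mops w P : Prop :=
  [/\ forall n, P n \is monic,
      forall n, size (P n) = n.+1,
      forall n m, n <> m -> w (P n * P m) = 0
    & forall n, w (P n ^+ 2) <> 0].

Definition regular_functional w : Prop := exists P, is_mops w P.

(* [back P n i] is the polynomial of index n - i in the integers: it is zero
   when i > n, unlike [P (n - i)%N]. *)
Definition back P (n i : nat) : {poly K} :=
  if (i <= n)%N then P (n - i)%N else 0.

Definition structure_relation (M N : nat) P Q : Prop :=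
  exists r s : nat -> nat -> K, forall n,
    Q n + \sum_(1 <= i < M) r i n *: back Q n i
    = P n + \sum_(1 <= i < N) s i n *: back P n i.

Definition degenerate23 P Q : Prop :=
  exists M N : nat,
    [/\ (0 < M)%N, (0 < N)%N, (M < 2)%N \/ (N < 3)%N
      & structure_relation M N P Q].

Definition nondegenerate23 P Q : Prop :=
  structure_relation 2 3 P Q /\ ~ degenerate23 P Q.

End OrthogonalPolynomials.

(* Main.v *)
(* Orthogonality turns a coefficient of [Q n] in the basis [P] into a value
   [u (P k * Q n)]. If [u (Q n) = 0] for [n > d] then [u = phi v] with [phi] of
   degree at most [d], and [phi] then determines all these coefficients; this
   gives (i)-(iii) and, with [u] and [v] exchanged, (iv-a), while the first zero
   of [r] (or of [s]) would produce a [phi] of a degree incompatible with the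
   relation. For (iv-b) and (v), a dimension count yields [Phi v = Psi u] with
   [deg Phi <= 2] and [deg Psi <= 1]; testing it on degree [n - 3] multiples of
   both sides of the relation shows that [t n] and [r n] are proportional, with
   a ratio that vanishes for all [n >= 3] or for none. *)
From HB Require Import structures.
Require Import Defs.
From mathcomp Require Import all_boot all_order all_algebra.
From mathcomp Require Import complex reals.
From mathcomp Require Import ring zify.

Set Implicit Arguments.
Unset Strict Implicit.
Unset Printing Implicit Defensive.

Import GRing.Theory.
Local Open Scope ring_scope.

(** * Polynomials graded by degree, and linear forms on them *)

Lemma coefM_top (K : fieldType) (p q : {poly K}) d m :
  (size p <= d.+1)%N -> (size q <= m.+1)%N -> (p * q)`_(d + m) = p`_d * q`_m.
Proof.
move=> sp sq; rewrite coefM.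
have dlt : (d < (d + m).+1)%N by lia.
rewrite (bigD1 (Ordinal dlt)) //= addKn big1 ?addr0 // => i.
rewrite -val_eqE /= => /eqP neq.
have [ltdi|ledi] := ltnP d i.
  by rewrite (nth_default _ (leq_trans sp ltdi)) mul0r.
have/(leq_trans sq) le : (m.+1 <= d + m - i)%N by lia.
by rewrite (nth_default _ le) mulr0.
Qed.

(** Subtracting a multiple of the monic [P N] lowers the degree bound. The restriction [m < N] in
    the step is what makes the principle usable for orthogonality to a fixed [P n]. *)
Lemma poly_graded_ind (K : fieldType) (P : nat -> {poly K})
    (T : {poly K} -> Prop) N (q : {poly K}) :
  (forall n, P n \is monic) -> (forall n, size (P n) = n.+1) ->
  T 0 -> (forall m c p, (m < N)%N -> T p -> T (c *: P m + p)) ->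
  (size q <= N)%N -> T q.
Proof.
move=> mP sP T0; elim: N q => [|N IHN] q Tadd sq.
  by move: sq; rewrite leqn0 size_poly_eq0 => /eqP ->.
rewrite -(subrKC (q`_N *: P N) q); apply: (Tadd N) => //.
apply: IHN => [m c p ltm|]; first by apply: (Tadd); apply: ltnW.
apply/leq_sizeP => j; rewrite leq_eqVlt => /predU1P[<-|ltj].
  have lcP : (P N)`_N = 1 by have /monicP := mP N; rewrite lead_coefE sP.
  by rewrite coefB coefZ lcP mulr1 subrr.
rewrite coefB coefZ (nth_default _ (leq_trans sq ltj))
  [(P N)`__]nth_default ?sP //.
by rewrite mulr0 subrr.
Qed.

Lemma scalar_graded_eq (K : fieldType) (f g : {scalar {poly K}})
    (P : nat -> {poly K}) :
  (forall n, P n \is monic) -> (forall n, size (P n) = n.+1) ->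
  (forall n, f (P n) = g (P n)) -> forall p, f p = g p.
Proof.
move=> mP sP fg p;
  apply: (@poly_graded_ind _ P (fun p => f p = g p) (size p)) => //.
  by rewrite !linear0.
by move=> m c q _ fgq; rewrite !linearD !linearZ fg fgq.
Qed.

(** Pairing with a row of coefficients becomes a row-by-matrix product, so that a dependence between
    functionals can be found by a rank argument. *)
Lemma scalar_rVpoly (K : fieldType) (w : {scalar {poly K}}) m (d : 'rV[K]_m)
    (q : {poly K}) :
  w (rVpoly d * q) = \sum_(i < m) d 0 i * w ('X^i * q).
Proof.
rewrite {1}[d]row_sum_delta linear_sum mulr_suml linear_sum /=.
by apply: eq_bigr => i _; rewrite linearZ /= rVpoly_delta -scalerAl linearZ.
Qed.

Section MulFunctional.

Variables (K : fieldType) (q : {poly K}) (w : {scalar {poly K}}).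

Definition mulF (p : {poly K}) : K := w (q * p).

Fact mulF_is_scalar : scalar mulF.
Proof. by move=> c p p'; rewrite /mulF mulrDr -scalerAr linearP. Qed.

HB.instance Definition _ :=
  GRing.isLinear.Build K {poly K} K _ mulF mulF_is_scalar.

End MulFunctional.

(** * A single monic orthogonal sequence and its functional *)

Section Mops.

Variables (K : fieldType) (w : {scalar {poly K}}) (P : nat -> {poly K}).
Hypothesis mopsP : is_mops w P.

Lemma mops_norm_neq0 n : w (P n ^+ 2) != 0.
Proof. by case: mopsP => _ _ _ /(_ n)/eqP. Qed.

Lemma mops_monic n : P n \is monic. Proof. by case: mopsP. Qed.

Lemma mops_size n : size (P n) = n.+1. Proof. by case: mopsP. Qed.

Lemma mops_coef n : (P n)`_n = 1.
Proof. by have /monicP := mops_monic n; rewrite lead_coefE mops_size. Qed.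

Lemma mops0 : P 0%N = 1.
Proof. by rewrite [P 0]size1_polyC ?mops_size // mops_coef. Qed.

Lemma mops_orth n (q : {poly K}) : (size q <= n)%N -> w (q * P n) = 0.
Proof.
apply: (@poly_graded_ind _ P (fun q => w (q * P n) = 0));
  [exact: mops_monic | exact: mops_size | | ].
  by rewrite mul0r linear0.
move=> m c p ltmn wp; rewrite mulrDl linearD wp -scalerAl linearZ /=.
case: mopsP => _ _ orth _; rewrite orth ?scaler0 ?addr0 ?mulr0 //; lia.
Qed.

Lemma mops_top n (q : {poly K}) :
  (size q <= n.+1)%N -> w (q * P n) = q`_n * w (P n ^+ 2).
Proof.
move=> sq; apply/eqP; rewrite -subr_eq0.
rewrite expr2 -linearZ scalerAl -linearB -mulrBl; apply/eqP/mops_orth.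
apply/leq_sizeP => j; rewrite leq_eqVlt => /predU1P[<-|ltj].
  by rewrite coefB coefZ mops_coef mulr1 subrr.
rewrite coefB coefZ (nth_default _ (leq_trans sq ltj))
  [(P n)`__]nth_default ?mops_size //.
by rewrite mulr0 subrr.
Qed.

Lemma mops_mul_top d m (p q : {poly K}) :
    (size p <= d.+1)%N -> (size q <= m.+1)%N ->
  w (p * q * P (d + m)%N) = p`_d * q`_m * w (P (d + m)%N ^+ 2).
Proof.
move=> sp sq; rewrite mops_top ?coefM_top //.
by apply: leq_trans (size_polyMleq _ _) _; lia.
Qed.

Lemma mops_mul_orth n (p q : {poly K}) :
  (size p + size q <= n.+1)%N -> w (p * q * P n) = 0.
Proof.
by move=> le; apply: mops_orth; apply: leq_trans (size_polyMleq _ _) _; lia.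
Qed.

(** A nonzero [d] pairs to a nonzero value with the [P] of its own degree. *)
Lemma mops_mul_inj (p q : {poly K}) :
  (forall f, w (p * f) = w (q * f)) -> p = q.
Proof.
move=> pq; apply/eqP; rewrite -subr_eq0 -lead_coef_eq0; set d := p - q.
have /eqP : w (d * P (size d).-1) = 0 by rewrite mulrBl linearB pq subrr.
by rewrite mops_top ?leqSpred // mulf_eq0 (negPf (mops_norm_neq0 _)) orbF.
Qed.

(** [g] is the Fourier expansion of [f] in the orthogonal basis [P], finite because [f] vanishes
    from [P N] on. *)
Lemma mops_repr (f : {scalar {poly K}}) N :
    (forall n, (N <= n)%N -> f (P n) = 0) ->
  exists2 g : {poly K}, (size g <= N)%N & forall p, f p = w (g * p).
Proof.
move=> f0; pose g := \sum_(i < N) (f (P i) / w (P i ^+ 2)) *: P i.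
exists g.
  apply: (big_ind (fun q : {poly K} => size q <= N)%N) => [|p q sp sq|i _].
  - by rewrite size_poly0.
  - by apply: leq_trans (size_polyD _ _) _; rewrite geq_max sp.
  - by apply: leq_trans (size_scale_leq _ _) _; rewrite mops_size.
apply: (@scalar_graded_eq _ f (mulF g w)); first exact: mops_monic.
  exact: mops_size.
case: mopsP => _ _ orth _.
move=> n; rewrite /= /mulF mulr_suml linear_sum /=.
have [leNn|ltnN] := leqP N n.
  rewrite f0 // big1 // => i _; rewrite -scalerAl linearZ /= (orth i n).
    by rewrite mulr0.
  by have := ltn_ord i; lia.
rewrite (bigD1 (Ordinal ltnN)) //= big1 ?addr0 => [|i].
  by rewrite -scalerAl linearZ /= -expr2 divfK ?mops_norm_neq0.
rewrite -val_eqE /= => /eqP neq.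
by rewrite -scalerAl linearZ /= (orth i n) ?mulr0.
Qed.

End Mops.

(** * Coefficients and recurrences drawn from the 2-3 relation *)

Section Relation23.

Variables (K : fieldType) (u v : {scalar {poly K}}) (P Q : nat -> {poly K}).
Variables (r s t : nat -> K).
Hypotheses (mopsP : is_mops u P) (mopsQ : is_mops v Q).
Hypothesis rel23 : forall n : nat,
  Q n + r n *: back Q n 1 = P n + s n *: back P n 1 + t n *: back P n 2.

(** The coefficients of [Q n] on [P n.-1] (for [n >= 1]) and on [P n.-2] (for [n >= 2]), by
    [coefQ_sub1] and [coefQ_sub2]. *)
Local Notation a n := (s n - r n).
Local Notation b n := (t n - r n * (s n.-1 - r n.-1)).

Lemma back_1 (S : nat -> {poly K}) n : back S n.+1 1 = S n.
Proof. by rewrite /back subn1. Qed.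

Lemma back_2 (S : nat -> {poly K}) n : back S n.+2 2 = S n.
Proof. by rewrite /back subn2. Qed.

Lemma rel23_1 : Q 1%N = P 1%N + (a 1%N)%:P.
Proof.
have := rel23 1; rewrite !back_1 [back P 1 2]/back /=.
rewrite (mops0 mopsP) (mops0 mopsQ).
rewrite scaler0 addr0 => /(canRL (addrK _)) ->.
by rewrite -addrA -scalerBl alg_polyC.
Qed.

Lemma rel23Q n : Q n.+2 =
  P n.+2 + s n.+2 *: P n.+1 + t n.+2 *: P n - r n.+2 *: Q n.+1.
Proof. by have := rel23 n.+2; rewrite !back_1 back_2 => /(canRL (addrK _)). Qed.

Lemma rel23P n : P n.+2 =
  Q n.+2 + r n.+2 *: Q n.+1 - s n.+2 *: P n.+1 - t n.+2 *: P n.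
Proof. by rewrite rel23Q subrK; ring. Qed.

Let h_neq0 n : u (P n ^+ 2) != 0 := mops_norm_neq0 mopsP n.
Let k_neq0 n : v (Q n ^+ 2) != 0 := mops_norm_neq0 mopsQ n.
Let sizeP n : size (P n) = n.+1 := mops_size mopsP n.
Let sizeQ n : size (Q n) = n.+1 := mops_size mopsQ n.

Lemma mulQP q n : u (q * Q n.+2) = u (q * P n.+2)
  + s n.+2 * u (q * P n.+1) + t n.+2 * u (q * P n) - r n.+2 * u (q * Q n.+1).
Proof.
by rewrite rel23Q mulrBr !mulrDr -!scalerAr linearB !linearD !linearZ.
Qed.

Lemma mulPQ q n : v (q * P n.+2) = v (q * Q n.+2)
  + r n.+2 * v (q * Q n.+1) - s n.+2 * v (q * P n.+1) - t n.+2 * v (q * P n).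
Proof.
by rewrite [in LHS]rel23P !mulrBr !mulrDr -!scalerAr !linearB !linearD !linearZ.
Qed.

Lemma coefQ_sub1 n : u (P n * Q n.+1) = a n.+1 * u (P n ^+ 2).
Proof.
case: n => [|n].
  rewrite rel23_1 mulrDr linearD (mops_orth mopsP) ?sizeP // add0r.
  by rewrite mulrC -alg_polyC -scalerAl linearZ /= (mops0 mopsP) expr1n mul1r.
rewrite mulQP (mops_orth mopsP) ?sizeP // [P _ * P n]mulrC.
rewrite [u (P n * _)](mops_orth mopsP) ?sizeP // [P _ * Q _]mulrC -expr2.
by rewrite (@mops_top _ _ _ mopsP _ (Q _)) ?sizeQ // (mops_coef mopsQ); ring.
Qed.

Lemma coefQ_sub2 n : u (P n * Q n.+2) = b n.+2 * u (P n ^+ 2).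
Proof.
rewrite mulQP -expr2 coefQ_sub1.
rewrite (@mops_orth _ _ _ mopsP n.+2) ?(@mops_orth _ _ _ mopsP n.+1) ?sizeP //.
by move=> /=; ring.
Qed.

(** All three [P] terms are orthogonal to [q], which leaves a recurrence of order one in [n]. *)
Lemma mulQP_low n (q : {poly K}) : (size q <= n)%N ->
  u (q * Q n.+2) = - r n.+2 * u (q * Q n.+1).
Proof.
move=> sq; rewrite mulQP !(mops_orth mopsP (leqW (leqW sq)),
  mops_orth mopsP (leqW sq), mops_orth mopsP sq); ring.
Qed.

Lemma coefP_sub1 n : v (Q n * P n.+1) = - a n.+1 * v (Q n ^+ 2).
Proof.
case: n => [|n].
  have -> : P 1%N = Q 1%N - (a 1%N)%:P by rewrite rel23_1 addrK.
  rewrite mulrBr linearB (mops_orth mopsQ) ?sizeQ // sub0r.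
  rewrite mulrC -alg_polyC -scalerAl linearZ /= (mops0 mopsQ) expr1n mul1r.
  by rewrite mulNr.
rewrite mulPQ -expr2 [Q _ * P n]mulrC [Q _ * P _]mulrC.
rewrite (@mops_orth _ _ _ mopsQ n.+2) ?(@mops_orth _ _ _ mopsQ n.+1 (P n));
  rewrite ?sizeP ?sizeQ //.
rewrite (@mops_top _ _ _ mopsQ _ (P _)) ?sizeP // (mops_coef mopsP); ring.
Qed.

(** Only the two [Q] terms have to vanish, so [q] may have one degree more than in [mulQP_low]; the
    recurrence that remains has order two. *)
Lemma mulPQ_low n (q : {poly K}) : (size q <= n.+1)%N ->
  v (q * P n.+2) = - s n.+2 * v (q * P n.+1) - t n.+2 * v (q * P n).
Proof.
move=> sq; rewrite mulPQ.
by rewrite !(mops_orth mopsQ (leqW sq), mops_orth mopsQ sq); ring.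
Qed.

Lemma coefP_sub2 n :
  v (Q n * P n.+2) = (s n.+2 * a n.+1 - t n.+2) * v (Q n ^+ 2).
Proof.
rewrite mulPQ_low ?sizeQ // coefP_sub1 [Q n * P n]mulrC.
by rewrite (@mops_top _ _ _ mopsQ _ (P _)) ?sizeP // (mops_coef mopsP); ring.
Qed.

(** Thus [b 2 = 0] exactly when [u] kills [Q 2], which separates (i) and (ii) from the other
    cases. *)
Lemma uQ2 : u (Q 2%N) = b 2%N * u (P 0 ^+ 2).
Proof. by have := coefQ_sub2 0; rewrite {1}(mops0 mopsP) mul1r. Qed.

Lemma uQ_rec n : u (Q n.+3) = - r n.+3 * u (Q n.+2).
Proof. by have := @mulQP_low n.+1 1; rewrite !mul1r size_poly1; apply. Qed.

Lemma vP1 : v (P 1%N) = - a 1%N * v (Q 0 ^+ 2).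
Proof. by have := coefP_sub1 0; rewrite {1}(mops0 mopsQ) mul1r. Qed.

(** The vanishing of this value separates (iv-a) from (iv-b). *)
Lemma vP2 : v (P 2%N) = (s 2%N * a 1%N - t 2%N) * v (Q 0 ^+ 2).
Proof. by have := coefP_sub2 0; rewrite {1}(mops0 mopsQ) mul1r. Qed.

Lemma vP_rec n : v (P n.+2) = - s n.+2 * v (P n.+1) - t n.+2 * v (P n).
Proof. by have := @mulPQ_low n 1; rewrite !mul1r size_poly1; apply. Qed.

(** * Vanishing and non-vanishing of the coefficients *)

Lemma uQ_eq0 m n : u (Q m.+2) = 0 -> (m <= n)%N -> u (Q n.+2) = 0.
Proof.
by move=> u0 /subnK <-; elim: (n - m)%N => // d IHd; rewrite uQ_rec IHd mulr0.
Qed.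

Lemma uQ_neq0 n : b 2%N != 0 -> (forall m, (m < n)%N -> r m.+3 != 0) ->
  u (Q n.+2) != 0.
Proof.
move=> b2; elim: n => [|n IHn] rn; first by rewrite uQ2 mulf_neq0.
rewrite uQ_rec mulNr oppr_eq0 mulf_neq0 ?rn // IHn // => m ltmn.
by apply: rn; apply: ltnW.
Qed.

(** Here [u = phi v] with [phi] of degree at most 1, and [x] is its coefficient of degree 1. Being
    the same for all [n], it makes [a n.+1] vanish always, as in (i), or never, as in (ii). *)
Lemma type12_coefs : b 2%N = 0 ->
  exists x, forall n, b n.+2 = 0 /\ a n.+1 * u (P n ^+ 2) = x * v (Q n.+1 ^+ 2).
Proof.
move=> b2; have u2 : u (Q 2) = 0 by rewrite uQ2 b2 mul0r.
have [[|[|n]] // _|phi sphi uE] := @mops_repr _ _ _ mopsQ u 2.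
  by rewrite (uQ_eq0 u2).
exists phi`_1 => n; split; last first.
  rewrite -coefQ_sub1 uE mulrA -[n.+1]add1n (mops_mul_top mopsQ) ?sizeP //.
  by rewrite (mops_coef mopsP) mulr1.
apply: (mulIf (h_neq0 n)); rewrite mul0r -coefQ_sub2 uE mulrA.
by rewrite (mops_mul_orth mopsQ) // sizeP; lia.
Qed.

(** Now [phi] has degree exactly 2, so [u (P n * Q n.+2)] is nonzero while [u (P n * Q n.+3)] is
    zero; their ratio is [- r n.+3]. *)
Lemma type13_coefs : b 2%N != 0 -> r 3%N = 0 ->
  forall n, b n.+2 != 0 /\ r n.+3 = 0.
Proof.
move=> b2 r3; have u3 : u (Q 3) = 0 by rewrite uQ_rec r3 oppr0 mul0r.
have [[|[|[|n]]] // _|phi sphi uE] := @mops_repr _ _ _ mopsQ u 3.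
  by rewrite (uQ_eq0 u3).
have phi2 : phi`_2 != 0.
  have : u (Q 2) != 0 by rewrite uQ2 mulf_neq0.
  by rewrite uE (mops_top mopsQ) // mulf_eq0 negb_or => /andP[].
move=> n; have bn : u (P n * Q n.+2) != 0.
  rewrite uE mulrA -[n.+2]add2n (mops_mul_top mopsQ) ?sizeP //.
  by rewrite (mops_coef mopsP) mulr1 mulf_neq0.
split; first by move: bn; rewrite coefQ_sub2 mulf_eq0 negb_or => /andP[].
have /eqP : u (P n * Q n.+3) = 0.
  by rewrite uE mulrA (mops_mul_orth mopsQ) // sizeP; lia.
rewrite mulQP_low ?sizeP // mulNr oppr_eq0 mulf_eq0 (negPf bn) orbF.
by move/eqP.
Qed.

(* At the first [m >= 4] with [r m = 0], [u = phi v] with [phi] of degree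
   exactly [m - 1], so that [u (P 1 * Q m)] is both zero and nonzero. *)
Lemma r_neq0 : b 2%N != 0 -> r 3%N != 0 -> forall n, r n.+3 != 0.
Proof.
move=> b2 r3; elim/ltn_ind => -[|n] // IHn; apply/eqP => rn.
have u2 : u (Q n.+3) != 0 by apply: uQ_neq0.
have u3 : u (Q n.+4) = 0 by rewrite uQ_rec rn oppr0 mul0r.
have [m|phi sphi uE] := @mops_repr _ _ _ mopsQ u n.+4.
  by case: m => [|[|m]] // lem; rewrite (uQ_eq0 u3).
have phin : phi`_(n.+3) != 0.
  by move: u2; rewrite uE (mops_top mopsQ) // mulf_eq0 negb_or => /andP[].
have /eqP : u (P 1 * Q n.+4) = 0.
  by rewrite mulQP_low ?sizeP // rn oppr0 mul0r.
apply/negP; rewrite uE mulrA -[n.+4]addn1 (mops_mul_top mopsQ) ?sizeP //.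
by rewrite (mops_coef mopsP) mulr1 mulf_neq0.
Qed.

(** With [t] gone the recurrence for [v (P n)] has order one, and the argument for [r] applies with
    [u] and [v] exchanged. It already works at index 3, thanks to the wider degree bound of
    [mulPQ_low]. *)
Lemma s_neq0 : s 2%N * a 1%N - t 2%N != 0 -> (forall n, t n.+3 = 0) ->
  forall n, s n.+3 != 0.
Proof.
move=> m2 t0; elim/ltn_ind => n IHn; apply/eqP => sn.
have v2 : v (P n.+2) != 0.
  elim: n IHn {sn} => [|n IH] sn; first by rewrite vP2 mulf_neq0.
  rewrite vP_rec t0 mul0r subr0 mulNr oppr_eq0 mulf_neq0 ?sn //.
  by apply: IH => m ltmn; apply: sn; apply: ltnW.
have v3 m : (n <= m)%N -> v (P m.+3) = 0.
  move=> /subnK <-; elim: (m - n)%N => [|d IHd].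
    by rewrite vP_rec t0 sn oppr0 !mul0r subr0.
  by rewrite vP_rec t0 IHd mulr0 mul0r subr0.
have [m|psi spsi vE] := @mops_repr _ _ _ mopsP v n.+3.
  by case: m => [|[|[|m]]] // lem; rewrite v3.
have psin : psi`_(n.+2) != 0.
  by move: v2; rewrite vE (mops_top mopsP) // mulf_eq0 negb_or => /andP[].
have /eqP : v (Q 1 * P n.+3) = 0.
  by rewrite mulPQ_low ?sizeQ // t0 sn oppr0 !mul0r subr0.
apply/negP; rewrite vE mulrA -[n.+3]addn1 (mops_mul_top mopsP) ?sizeQ //.
by rewrite (mops_coef mopsQ) mulr1 mulf_neq0.
Qed.

(** Substituting the expansion of [Q n.+2] into the relation for [Q n.+3] yields one term three
    degrees below the top, with coefficient [- r n.+3 * b n.+2]. *)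
Lemma Q_expansion : (forall n, r n.+3 * b n.+2 = 0) ->
  forall n, Q n = P n + a n *: back P n 1 + b n *: back P n 2.
Proof.
move=> rb [|n].
  by rewrite /back /= !scaler0 !addr0 (mops0 mopsP) (mops0 mopsQ).
elim: n => [|n IHn].
  by rewrite rel23_1 back_1 (mops0 mopsP) /back /= scaler0 addr0 alg_polyC.
rewrite rel23Q IHn !back_1 back_2.
case: n IHn => [|n] IHn.
  rewrite /back /= scaler0 addr0 /=.
  by rewrite -!mul_polyC !(polyCB, polyCM); ring.
rewrite back_2 scalerDr scalerA rb scale0r addr0 /=.
by rewrite -!mul_polyC !(polyCB, polyCM); ring.
Qed.

(* The functionals [v], [x v], [x^2 v], [u], [x u] all vanish on
   [Q n + r n *: Q n.-1] for [n >= 4], so these five are linearly dependent. *)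
Lemma pencil : exists Phi Psi : {poly K},
  [/\ (size Phi <= 3)%N, (size Psi <= 2)%N, Psi != 0
    & forall p, v (Phi * p) = u (Psi * p)].
Proof.
pose W n := Q n + r n *: back Q n 1.
have backlt n : (size (r n *: back Q n 1) < n.+1)%N.
  apply: leq_ltn_trans (size_scale_leq _ _) _; case: n => [|n].
    by rewrite /back size_poly0.
  by rewrite back_1 sizeQ.
have sizeW n : size (W n) = n.+1 by rewrite size_polyDl sizeQ.
have monicW n : W n \is monic.
  by rewrite monicE lead_coefDl ?sizeQ //; apply: (mops_monic mopsQ).
(* Five rows against the four columns [W 0] to [W 3]: a nonzero row [c] lies in the left kernel. It
   holds the coefficients of [Phi], then those of [- Psi]. *)
pose A := \matrix_(i < 3, j < 4) v ('X^i * W j).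
pose B := \matrix_(i < 2, j < 4) u ('X^i * W j).
pose C := col_mx A B.
have /rowV0Pn[c] : kermx C != 0.
  rewrite -mxrank_eq0 mxrank_ker -lt0n subn_gt0.
  by rewrite (leq_ltn_trans (rank_leq_col C)).
move=> /sub_kermxP cC c0.
pose Phi := rVpoly (lsubmx c); pose Psi := - rVpoly (rsubmx c).
have sPhi : (size Phi <= 3)%N by apply: size_poly.
have sPsi : (size Psi <= 2)%N by rewrite size_polyN; apply: size_poly.
have PhiPsi p : v (Phi * p) = u (Psi * p).
  apply: (@scalar_graded_eq _ (mulF Phi v) (mulF Psi u) W) => // n.
  rewrite /= /mulF; have [ltn4|le4n] := ltnP n 4.
    have := congr1 (fun M : 'rV_4 => M 0 (Ordinal ltn4)) cC.
    rewrite -[c]hsubmxK mul_row_col !mxE => /eqP.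
    rewrite addrC addr_eq0 => /eqP E.
    rewrite /Phi /Psi mulNr linearN !scalar_rVpoly /=; move: E.
    have AE i : A i (Ordinal ltn4) = v ('X^i * W n) by rewrite mxE.
    have BE i : B i (Ordinal ltn4) = u ('X^i * W n) by rewrite mxE.
    rewrite (eq_bigr _ (fun i _ => congr1 ( *%R (rsubmx c 0 i)) (BE i))).
    rewrite (eq_bigr _ (fun i _ => congr1 ( *%R (lsubmx c 0 i)) (AE i))).
    by move=> ->; rewrite opprK.
  (* [W n] is read in [Q] under [v] and in [P] under [u]; from [n = 4] on, every index that occurs
     exceeds the degree of [Phi], respectively of [Psi]. *)
  case: n le4n => [|[|n]] // le4n; rewrite {2}/W rel23 /W !back_1 back_2.
  rewrite !mulrDr -!scalerAr !linearD !linearZ /=.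
  rewrite !(mops_orth mopsQ) ?(mops_orth mopsP) ?mulr0 ?addr0 //;
    by [apply: leq_trans sPhi _; lia | apply: leq_trans sPsi _; lia].
exists Phi, Psi; split => //; apply/eqP => Psi0.
have Phi0 : Phi = 0.
  by apply: (mops_mul_inj mopsQ) => p; rewrite PhiPsi Psi0 !mul0r !linear0.
case/negP: c0; rewrite -[c]hsubmxK.
move/eqP: Psi0; rewrite oppr_eq0 => /eqP Psi0.
by rewrite -[lsubmx c]rVpolyK -[rsubmx c]rVpolyK [rVpoly _]Phi0
  [rVpoly _]Psi0 !linear0 row_mx0.
Qed.

(** * Consequences of an identity [Phi v = Psi u] *)

Section Pencil.

Variables Phi Psi : {poly K}.
Hypotheses (sPhi : (size Phi <= 3)%N) (sPsi : (size Psi <= 2)%N).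
Hypothesis PhiPsi : forall p, v (Phi * p) = u (Psi * p).

(** The degree of ['X^n] is the one for which a single term survives on each side: [P n.+1] under
    [u] and [Q n.+2] under [v]. *)
Lemma pencil_top n :
  t n.+3 * (Psi`_1 * u (P n.+1 ^+ 2)) = r n.+3 * (Phi`_2 * v (Q n.+2 ^+ 2)).
Proof.
have sX : (size ('X^n : {poly K}) <= n.+1)%N by rewrite size_polyXn.
have Xn : ('X^n : {poly K})`_n = 1 by rewrite coefXn eqxx.
have uPX : u (Psi * 'X^n * P n.+1) = Psi`_1 * u (P n.+1 ^+ 2).
  by rewrite -[n.+1]add1n (mops_mul_top mopsP) // Xn mulr1.
have vQX : v (Phi * 'X^n * Q n.+2) = Phi`_2 * v (Q n.+2 ^+ 2).
  by rewrite -[n.+2]add2n (mops_mul_top mopsQ) // Xn mulr1.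
have vQ0 : v (Phi * 'X^n * Q n.+3) = 0.
  by apply: (mops_mul_orth mopsQ); rewrite size_polyXn; lia.
have := mulQP (Psi * 'X^n) n.+1.
rewrite uPX !(mops_mul_orth mopsP) ?size_polyXn; try lia.
rewrite -!mulrA -!PhiPsi !mulrA vQX vQ0 mulr0 !add0r => /esym/eqP.
by rewrite subr_eq0 => /eqP; rewrite -!mulrA.
Qed.

(** If [Phi] has degree at most 1 then [u (Psi * Q 2) = v (Phi * Q 2) = 0]; a nonzero constant [Psi]
    would give [u (Q 2) = 0]. *)
Lemma pencil_neq0 : b 2%N != 0 -> Psi != 0 -> Phi`_2 = 0 -> Psi`_1 != 0.
Proof.
move=> b2 Psi0 Phi2; apply: contraNneq Psi0 => Psi1.
have PsiC : Psi = (Psi`_0)%:P.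
  apply: size1_polyC; apply/leq_sizeP => -[|[|j]] // _.
  exact: (nth_default _ (leq_trans sPsi _)).
have /eqP : v (Phi * Q 2) = 0 by rewrite (mops_top mopsQ) // Phi2 mul0r.
rewrite PhiPsi PsiC mul_polyC linearZ /= uQ2 !mulf_eq0 (negPf b2) polyC_eq0.
by rewrite (negPf (h_neq0 0)) !orbF.
Qed.

(* A relation of type [M-2] makes the vectors [(v (P n), v (x P n))] pairwise
   proportional for large [n], so some nonzero [p] of degree at most 1 satisfies
   [p v = g u]; compared with [Phi v = Psi u] this forces [g] to be constant,
   whence [u (Q 2) = 0]. *)
Lemma not_structure_relation_M2 M N : b 2%N != 0 -> Phi`_2 != 0 ->
  (0 < N < 3)%N -> ~ structure_relation M N P Q.
Proof.
move=> b2 Phi2 N3 [r' [s' rel]].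
(* For [n >= M.+2] every [Q] in the relation has index at least 2, hence is orthogonal to [p]. *)
have [c vP] : exists c : nat -> K, forall n (p : {poly K}),
    (M.+2 <= n)%N -> (size p <= 2)%N -> v (p * P n) = c n * v (p * P n.-1).
  exists (fun n => if N == 2 then - s' 1%N n else 0) => n p leMn sp.
  have /(congr1 (fun q => v (p * q))) := rel n.
  rewrite !mulrDr !linearD !mulr_sumr !linear_sum /=.
  rewrite (mops_orth mopsQ); last by lia.
  rewrite add0r big_nat_cond big1 => [|i /andP[/andP[i0 ltiM] _]]; last first.
    rewrite -scalerAr linearZ /= /back ifT; last by lia.
    by rewrite (mops_orth mopsQ) ?mulr0 //; lia.
  move/esym/eqP; rewrite addr_eq0 => /eqP ->.
  have [->|N1] : N = 2 \/ N = 1%N by lia.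
    rewrite big_nat1 -scalerAr linearZ /= /back ifT; last by lia.
    by rewrite subn1 mulNr.
  by rewrite N1 big_geq // oppr0 mul0r.
have [p [p0 sp vp]] : exists p : {poly K},
    [/\ p != 0, (size p <= 2)%N & v (p * P M.+2) = 0].
  have [x0|x0] := eqVneq (v (P M.+2)) 0.
    by exists 1; rewrite oner_eq0 size_poly1 mul1r.
  exists ((v ('X * P M.+2))%:P - v (P M.+2) *: 'X); split.
  - apply: contra_neq x0 => /(congr1 (fun q : {poly K} => - q`_1)).
    by rewrite coefB coefC coefZ coefX sub0r mulr1 opprK coef0 oppr0.
  - apply: leq_trans (size_polyD _ _) _; rewrite geq_max size_polyN.
    rewrite (leq_trans (size_polyC_leq1 _)) //.
    by apply: leq_trans (size_scale_leq _ _) _; rewrite size_polyX.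
  - rewrite mulrBl linearB mul_polyC -scalerAl !linearZ /=.
    by rewrite mulrC subrr.
have [n|g sg pg] := @mops_repr _ _ _ mopsP (mulF p v) M.+2.
  rewrite /= /mulF => /subnK <-; elim: (n - _)%N => [|d IHd] //.
  rewrite vP // ?leq_addl //; rewrite addSn in IHd *.
  by rewrite -pred_Sn IHd mulr0.
rewrite /= /mulF in pg.
(* Both products, applied to [u], give [p Phi v]. As [Phi] has degree 2 and [p], [Psi] at most 1, no
   degree is left for [g]. *)
have pPsi : p * Psi = g * Phi.
  apply: (mops_mul_inj mopsP) => q.
  by rewrite -mulrA mulrCA -PhiPsi mulrCA pg mulrA.
have g0 : g != 0.
  apply: contra_neq p0 => g0; apply: (mops_mul_inj mopsQ) => q.
  by rewrite pg g0 !mul0r !linear0.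
have gC : g = (g`_0)%:P.
  apply: size1_polyC; have Phi0 : Phi != 0.
    by apply: contra_neq Phi2 => ->; rewrite coef0.
  have := size_polyMleq p Psi; rewrite pPsi size_mul //.
  have : (2 < size Phi)%N
    by apply: contraTltn Phi2 => le; rewrite negbK nth_default.
  by move: sp sPsi; move: (size p) (size Psi) (size g) (size Phi); lia.
have /eqP : v (p * Q 2) = 0 by rewrite (mops_orth mopsQ).
rewrite pg gC mul_polyC linearZ /= uQ2 !mulf_eq0 (negPf b2).
by rewrite (negPf (h_neq0 0)) !orbF -polyC_eq0 -gC (negPf g0).
Qed.

End Pencil.

(** Such a relation makes [u] vanish on [Q n] for large [n], whereas nonzero [r] keep [u (Q n)]
    nonzero for all [n >= 2]. *)
Lemma not_structure_relation_1N N : b 2%N != 0 -> (forall n, r n.+3 != 0) ->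
  ~ structure_relation 1 N P Q.
Proof.
move=> b2 r0 [r' [s' rel]].
have uP n : (0 < n)%N -> u (P n) = 0.
  by move=> n0; rewrite -[P n]mul1r (mops_orth mopsP) ?size_poly1.
have /eqP : u (Q N.+2) != 0 by apply: uQ_neq0.
have := rel N.+2; rewrite [in LHS]big_geq // addr0 => ->; apply.
rewrite linearD linear_sum /= uP // add0r big_nat_cond big1 // => i.
rewrite andbT => /andP[i0 ltiN]; rewrite linearZ /= /back ifT; last by lia.
by rewrite uP ?mulr0 //; lia.
Qed.

(** The hypotheses give two consecutive zeros [v (P 2)] and [v (P 3)], as the order-two recurrence
    requires. So [v = psi u] with [psi] of degree exactly 1, because [a 1] is nonzero. *)
Lemma type21_coefs : b 2%N != 0 -> t 3%N = 0 -> t 2%N = s 2%N * a 1%N ->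
  forall n, [/\ t n.+3 = 0, s n.+3 = 0 & r n.+1 - s n.+1 != 0].
Proof.
move=> b2 t3 t2.
have a1 : a 1%N != 0 by apply: contra_neq b2; rewrite /= t2 => ->; ring.
have vP0 n : v (P n.+2) = 0.
  suff: v (P n.+2) = 0 /\ v (P n.+3) = 0 by case.
  elim: n => [|n [v2 v3]].
    have v2 : v (P 2) = 0 by rewrite vP2 t2 subrr mul0r.
    by split; rewrite // vP_rec v2 t3; ring.
  by split; rewrite // vP_rec v2 v3 !mulr0 subr0.
have [[|[|n]] // _|psi spsi vE] := @mops_repr _ _ _ mopsP v 2.
have psi1 : psi`_1 != 0.
  have : v (P 1) != 0 by rewrite vP1 mulf_neq0 ?oppr_eq0.
  by rewrite vE (mops_top mopsP) // mulf_eq0 negb_or => /andP[].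
have vQP n : v (Q n * P n.+1) != 0.
  rewrite vE mulrA -[n.+1]add1n (mops_mul_top mopsP) ?sizeQ //.
  by rewrite (mops_coef mopsQ) mulr1 mulf_neq0.
have vQP0 m n : (m < n)%N -> v (Q m * P n.+1) = 0.
  by move=> lt; rewrite vE mulrA (mops_mul_orth mopsP) // sizeQ; lia.
move=> n; have tn : t n.+3 = 0.
  have /eqP := vQP0 n n.+2 (ltnW (ltnSn _)).
  rewrite mulPQ_low ?sizeQ // vQP0 // mulr0 sub0r oppr_eq0 mulf_eq0.
  by rewrite (negPf (vQP n)) orbF => /eqP.
have an m : a m.+1 != 0.
  have := vQP m; rewrite coefP_sub1 mulNr oppr_eq0 mulf_eq0 negb_or.
  by case/andP.
split=> //; last by rewrite -oppr_eq0 opprB.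
have /eqP := vQP0 n.+1 n.+2 (ltnSn _).
rewrite coefP_sub2 tn subr0 !mulf_eq0 (negPf (an _)) (negPf (k_neq0 _)).
by rewrite !orbF => /eqP.
Qed.

Lemma P_expansion : (forall n, t n.+3 = 0) -> (forall n, s n.+3 = 0) ->
  t 2%N = s 2%N * a 1%N -> forall n, Q n + (r n - s n) *: back Q n 1 = P n.
Proof.
move=> t0 s0 t2 [|[|[|n]]].
- by rewrite /back scaler0 addr0 (mops0 mopsP) (mops0 mopsQ).
- rewrite back_1 rel23_1 (mops0 mopsQ) -alg_polyC -addrA -scalerDl.
  by rewrite addrC subrKA subrr scale0r add0r.
(* Since [P 1] is [Q 1] minus the constant [a 1], the constant [s 2 * a 1] cancels [t 2]. *)
- rewrite [RHS]rel23P back_1 rel23_1 (mops0 mopsP) t2 -!mul_polyC.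
  by rewrite !(polyCB, polyCM); ring.
- by rewrite [RHS]rel23P back_1 s0 t0 !scale0r !subr0.
Qed.

End Relation23.

(** * Assembly of the cases (i) to (v) over the complex numbers *)

Theorem theorem2p1 (R : realType) (u v : {scalar {poly R[i]}})
    (P Q : nat -> {poly R[i]}) (r s t : nat -> R[i])
    (u_reg : regular_functional u) (v_reg : regular_functional v)
    (mopsP : is_mops u P) (mopsQ : is_mops v Q)
    (u1 : u 1 = 1) (v1 : v 1 = 1)
    (r0 : r 0%N = 0) (s0 : s 0%N = 0) (t0 : t 0%N = 0) (t1 : t 1%N = 0)
    (rel23 : forall n : nat,
      Q n + r n *: back Q n 1
      = P n + s n *: back P n 1 + t n *: back P n 2) :
  (* (i) *)
  (t 2%N = r 2%N * (s 1%N - r 1%N) -> s 1%N = r 1%N ->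
    [/\ forall n : nat, (2 <= n)%N -> t n = 0,
        forall n : nat, (1 <= n)%N -> s n = r n
      & forall n : nat, Q n = P n])
  /\
  (* (ii) *)
  (t 2%N = r 2%N * (s 1%N - r 1%N) -> s 1%N <> r 1%N ->
    [/\ forall n : nat, (2 <= n)%N -> t n = r n * (s n.-1 - r n.-1),
        forall n : nat, (1 <= n)%N -> s n <> r n
      & let a := fun n : nat => s n - r n in
        (forall n : nat, Q n = P n + a n *: back P n 1)
        /\ (forall n : nat, (1 <= n)%N -> a n <> 0)])
  /\
  (* (iii) *)
  (t 2%N <> r 2%N * (s 1%N - r 1%N) -> r 3%N = 0 ->
    [/\ forall n : nat, (2 <= n)%N -> t n <> r n * (s n.-1 - r n.-1),
        forall n : nat, (3 <= n)%N -> r n = 0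
      & let a := fun n : nat => s n - r n in
        let b := fun n : nat => t n - r n * (s n.-1 - r n.-1) in
        (forall n : nat, Q n = P n + a n *: back P n 1 + b n *: back P n 2)
        /\ (forall n : nat, (2 <= n)%N -> b n <> 0)])
  /\
  (* (iv) *)
  (t 2%N <> r 2%N * (s 1%N - r 1%N) -> r 3%N <> 0 ->
    [/\ forall n : nat, (3 <= n)%N -> r n <> 0,
        (* (iv-a) *)
        t 3%N = 0 -> t 2%N = s 2%N * (s 1%N - r 1%N) ->
          (forall n : nat, (3 <= n)%N -> t n = 0 /\ s n = 0)
          /\ (let c := fun n : nat => r n - s n in
              (forall n : nat, Q n + c n *: back Q n 1 = P n)
              /\ (forall n : nat, (1 <= n)%N -> c n <> 0))
      & (* (iv-b) *)
        t 3%N = 0 -> t 2%N <> s 2%N * (s 1%N - r 1%N) ->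
          [/\ forall n : nat, (3 <= n)%N -> t n = 0,
              forall n : nat, (3 <= n)%N -> s n <> 0,
              s 1%N <> r 1%N ->
                (exists c1 d1 : R[i],
                  [/\ c1 <> 0, d1 <> 0 & c1 - d1 = r 1%N - s 1%N])
                /\ (forall c d : nat -> R[i],
                     c 1%N <> 0 -> d 1%N <> 0 ->
                     c 1%N - d 1%N = r 1%N - s 1%N ->
                     c 2%N = r 2%N - t 2%N / (s 1%N - r 1%N) ->
                     d 2%N = s 2%N - t 2%N / (s 1%N - r 1%N) ->
                     (forall n : nat, (3 <= n)%N -> c n = r n /\ d n = s n) ->
                     (forall n : nat,
                       Q n + c n *: back Q n 1 = P n + d n *: back P n 1)
                     /\ (forall n : nat, (1 <= n)%N -> c n * d n <> 0))
            & s 1%N = r 1%N ->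
                [/\ Q 1%N = P 1%N,
                    Q 2%N + r 2%N *: Q 1%N
                    = P 2%N + s 2%N *: P 1%N + (t 2%N)%:P
                  & forall n : nat, (3 <= n)%N ->
                      Q n + r n *: Q n.-1 = P n + s n *: P n.-1]]])
  /\
  (* (v) *)
  (t 2%N <> r 2%N * (s 1%N - r 1%N) -> r 3%N * t 3%N <> 0 ->
    (forall n : nat, (3 <= n)%N -> r n * t n <> 0)
    /\ nondegenerate23 P Q).

Proof.
have relE n : (3 <= n)%N -> t n = 0 ->
    Q n + r n *: Q n.-1 = P n + s n *: P n.-1.
  by case: n => // n _ tn; have := rel23 n.+1; rewrite !back_1 tn scale0r addr0.
have rel1 := rel23_1 mopsP mopsQ rel23.
split; [|split; [|split; [|split]]].
- move=> t2 s1; have b2 : t 2%N - r 2%N * (s 1%N - r 1%N) = 0.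
    by rewrite t2 subrr.
  have [x bx] := type12_coefs mopsP mopsQ rel23 b2.
  have x0 : x = 0.
    have [_ /esym/eqP] := bx 0%N; rewrite s1 subrr mul0r mulf_eq0.
    by rewrite (negPf (mops_norm_neq0 mopsQ _)) orbF => /eqP.
  have a0 n : s n.+1 = r n.+1.
    have [_ /eqP] := bx n; rewrite x0 mul0r mulf_eq0 subr_eq0.
    by rewrite (negPf (mops_norm_neq0 mopsP _)) orbF => /eqP.
  have t_eq0 n : t n.+2 = 0.
    by have [/=] := bx n; rewrite a0 subrr mulr0 subr0.
  split=> [[|[|n]]|[|n]|] //.
  have QE := Q_expansion mopsP mopsQ rel23 _.
  move=> n; rewrite QE => [|m]; last by have [-> _] := bx m; rewrite mulr0.
  case: n => [|[|n]].
  - by rewrite /back !scaler0 !addr0.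
  - by rewrite a0 subrr scale0r /back scaler0 !addr0.
  - by have [-> _] := bx n; rewrite a0 subrr !scale0r !addr0.
- move=> t2 /eqP s1; have b2 : t 2%N - r 2%N * (s 1%N - r 1%N) = 0.
    by rewrite t2 subrr.
  have [x bx] := type12_coefs mopsP mopsQ rel23 b2.
  have x0 : x != 0.
    apply: contra_neq s1 => x0; have [_ /eqP] := bx 0%N.
    rewrite x0 mul0r mulf_eq0 subr_eq0.
    by rewrite (negPf (mops_norm_neq0 mopsP _)) orbF => /eqP.
  have a0 n : s n.+1 - r n.+1 != 0.
    have [_ E] := bx n; have : x * v (Q n.+1 ^+ 2) != 0.
      by rewrite mulf_neq0 // (mops_norm_neq0 mopsQ).
    by rewrite -E mulf_eq0 negb_or => /andP[].
  split=> [[|[|n]] // _|[|n] // _|/=].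
  + by apply/eqP; rewrite -subr_eq0; have [-> _] := bx n.
  + by apply/eqP; rewrite -subr_eq0.
  split=> [n|[|n] // _]; last exact/eqP.
  rewrite (Q_expansion mopsP mopsQ rel23) => [|m]; last first.
    by have [-> _] := bx m; rewrite mulr0.
  case: n => [|[|n]].
  - by rewrite /back /= !scaler0 !addr0.
  - by rewrite [back P 1 2]/back /= scaler0 addr0.
  by have [-> _] := bx n; rewrite scale0r addr0.
- move=> /eqP; rewrite -subr_eq0 => b2 r3.
  have br := type13_coefs mopsP mopsQ rel23 b2 r3.
  split=> [[|[|n]] // _|[|[|[|n]]] // _|/=].
  + by have [] := br n; rewrite subr_eq0 => /eqP.
  + by have [] := br n.
  split=> [n|[|[|n]] // _]; last by have [/eqP] := br n.
  rewrite (Q_expansion mopsP mopsQ rel23) => // m.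
  by have [_ ->] := br m; rewrite mul0r.
- move=> /eqP; rewrite -subr_eq0 => b2 /eqP r3.
  have r_n0 := r_neq0 mopsP mopsQ rel23 b2 r3.
  split=> [[|[|[|n]]] // _|t3 t2|t3 /eqP t2]; first exact/eqP.
    have vr := type21_coefs mopsP mopsQ rel23 b2 t3 t2.
    split=> [[|[|[|n]]] // _|/=]; first by have [] := vr n.
    split=> [|[|n] // _]; last by have [_ _ /eqP] := vr n.
    by apply: (P_expansion mopsP mopsQ rel23) => // n; have [] := vr n.
  have [Phi [Psi [sPhi sPsi Psi0 PhiPsi]]] := pencil mopsP mopsQ rel23.
  have top := pencil_top mopsP mopsQ rel23 sPhi sPsi PhiPsi.
  (* As [t 3 = 0] and [r 3] is nonzero, [Phi] loses its top coefficient; then [Psi] keeps its own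
     and every later [t] vanishes. *)
  have Phi2 : Phi`_2 = 0.
    have /esym/eqP := top 0%N; rewrite t3 mul0r !mulf_eq0 (negPf r3).
    by rewrite (negPf (mops_norm_neq0 mopsQ _)) orbF => /eqP.
  have Psi1 := pencil_neq0 mopsP mopsQ rel23 sPhi sPsi PhiPsi b2 Psi0 Phi2.
  have t_eq0 n : t n.+3 = 0.
    have /eqP := top n; rewrite Phi2 mul0r mulr0 !mulf_eq0 (negPf Psi1).
    by rewrite (negPf (mops_norm_neq0 mopsP _)) !orbF => /eqP.
  have s2 : s 2%N * (s 1%N - r 1%N) - t 2%N != 0 by rewrite subr_eq0 eq_sym.
  have s_n0 := s_neq0 mopsP mopsQ rel23 s2 t_eq0.
  split=> [[|[|[|n]]] // _|[|[|[|n]]] // _|s1|s1].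
  + exact/eqP.
  + have a1 : s 1%N - r 1%N != 0 by rewrite subr_eq0; apply/eqP.
    split.
      (* Any two nonzero numbers with difference [r 1 - s 1] would do; these are nonzero because 2
         is. *)
      exists (- (2 * (s 1%N - r 1%N))), (- (s 1%N - r 1%N)).
      split; [| |by ring]; apply/eqP; rewrite oppr_eq0 ?mulf_neq0 //.
      by rewrite Num.Theory.pnatr_eq0.
    move=> c d /eqP c1 /eqP d1 cd c2 d2 cdn.
    split=> [[|[|[|n]]]|[|[|[|n]]] // _].
    * by rewrite /back !scaler0 !addr0 (mops0 mopsP) (mops0 mopsQ).
    * rewrite !back_1 rel1 (mops0 mopsP) (mops0 mopsQ) -alg_polyC.
      rewrite -!addrA -scalerDl.
      by congr (_ + _ *: _); rewrite -(opprB (r 1%N)) -cd; ring.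
    (* [Q 1 - P 1] is the constant [s 1 - r 1], so [t 2] equals [k] times it, which shifts both
       coefficients by [k]. *)
    * set k := t 2%N / _ in c2 d2.
      have tk : t 2%N = k * (s 1%N - r 1%N) by rewrite divfK.
      have := rel23 2; rewrite !back_1 back_2 c2 d2 tk rel1 (mops0 mopsP).
      move/(canRL (addrK _)) => ->; rewrite -!mul_polyC.
      by rewrite !(polyCB, polyCM); ring.
    * by case: (cdn n.+3) => // -> ->; rewrite !back_1 relE.
    * by apply/eqP; rewrite mulf_neq0.
    * apply/eqP; rewrite c2 d2 mulf_neq0 // subr_eq0.
        by apply: contra_neq b2 => ->; rewrite divfK ?subrr.
      by apply: contra_neq s2 => ->; rewrite divfK ?subrr.
    * by case: (cdn n.+3) => // -> ->; apply/eqP; rewrite mulf_neq0.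
  + have Q1 : Q 1%N = P 1%N by rewrite rel1 s1 subrr addr0.
    split=> // [|[|[|[|n]]] // _]; last exact: relE.
    by have := rel23 2; rewrite !back_1 back_2 (mops0 mopsP) alg_polyC.
- move=> /eqP; rewrite -subr_eq0 => b2 /eqP; rewrite mulf_eq0 negb_or.
  case/andP=> r3 t3.
  have r_n0 := r_neq0 mopsP mopsQ rel23 b2 r3.
  have [Phi [Psi [sPhi sPsi Psi0 PhiPsi]]] := pencil mopsP mopsQ rel23.
  have top := pencil_top mopsP mopsQ rel23 sPhi sPsi PhiPsi.
  (* Otherwise [Psi] would have degree 1 and [top 0] would force [t 3 = 0]. *)
  have Phi2 : Phi`_2 != 0.
    apply/eqP => Phi2.
    have Psi1 := pencil_neq0 mopsP mopsQ rel23 sPhi sPsi PhiPsi b2 Psi0 Phi2.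
    have /eqP := top 0%N; rewrite Phi2 mul0r mulr0 !mulf_eq0 (negPf t3).
    by rewrite (negPf Psi1) (negPf (mops_norm_neq0 mopsP _)).
  split=> [[|[|[|n]]] // _|].
    apply/eqP; rewrite mulf_neq0 //.
    apply: (contra_eq_neq _ (top n)) => ->; rewrite mul0r eq_sym.
    by rewrite !mulf_neq0 // (mops_norm_neq0 mopsQ).
  split.
    exists (fun=> r), (fun i => if i == 1%N then s else t); move=> n.
    by rewrite big_nat1 big_nat_recl // big_nat1 addrA; apply: rel23.
  case=> M [N [M0 N0 MN rel]].
  have [M1|N3] : M = 1%N \/ (0 < N < 3)%N by lia.
    rewrite M1 in rel.
    exact: (not_structure_relation_1N mopsP mopsQ rel23 b2 r_n0 rel).
  exact: (not_structure_relation_M2 mopsP mopsQ rel23 sPhi sPsi PhiPsi b2 Phi2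
    N3 rel).
Qed.
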